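(* For every MV-algebra $A$, its profinite completion $\widehat A$ is algebraically and topologically isomorphic to $\prod_{M\in\mathrm{Max}_f(A)}A/M$, where $\mathrm{Max}_f(A)$ is the set of maximal ideals of $A$ of finite rank.
   Context: An MV-algebra is an abelian monoid $(A,\oplus,0)$ with an involution $\neg$ satisfying $\neg0\oplus x=\neg0$ and $\neg(\neg x\oplus y)\oplus y=\neg(\neg y\oplus x)\oplus x$. A maximal ideal $M$ of $A$ has finite rank if $A/M$ is finite. The profinite completion $\widehat A$ is the inverse limit of the finite quotients $A/I$ ($I$ ranging over ideals with $A/I$ finite, directed by reverse inclusion, with natural quotient maps), equipped with the inverse limit topology of the discrete finite quotients; the product $\prod_{M}A/M$ carries the product of discrete topologies. *)

(* Defs.v *)
From HB Require Import structures.
From mathcomp Require Import all_boot ssralg generic_quotient.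
From mathcomp Require Import all_classical topology function_spaces.

Set Implicit Arguments.
Unset Strict Implicit.
Unset Printing Implicit Defensive.

Import GRing.Theory.
Local Open Scope classical_set_scope.
Local Open Scope ring_scope.
Local Open Scope quotient_scope.

(* The monoid operation of an MV-algebra is written [+] (it is the paper's
   \oplus), its unit [0].  [nmodType] also carries a choice structure; by
   [boolp] every type has one. *)
HB.mixin Record Nmodule_isMVAlgebra A of GRing.Nmodule A := {
  mvneg : A -> A;
  mvnegK : involutive mvneg;
  mvadd1 : forall x : A, mvneg 0 + x = mvneg 0;
  mv_lukasiewicz : forall x y : A,
    mvneg (mvneg x + y) + y = mvneg (mvneg y + x) + x
}.

#[short(type="mvType")]
HB.structure Definition MVAlgebra :=
  {A of GRing.Nmodule A & Nmodule_isMVAlgebra A}.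

#[short(type="topMVType")]
HB.structure Definition TopMV := {A of MVAlgebra A & Topological A}.

Section MVOrder.
Variable A : mvType.
Implicit Types x y z u v : A.

Definition mvone : A := mvneg 0.

Definition mvle x y : Prop := mvneg x + y = mvone.

Definition mvsub x y : A := mvneg (mvneg x + y).

Definition mvdist x y : A := mvsub x y + mvsub y x.

Lemma mvnegxx x : mvneg x + x = mvone.
Proof.
have := mv_lukasiewicz x (mvneg 0).
by rewrite [LHS]addrC mvadd1 mvnegK add0r => <-.
Qed.

Lemma mvle_addr x y : mvle x (x + y).
Proof. by rewrite /mvle addrA mvnegxx mvadd1. Qed.

Lemma mvle_subK x y : mvle x y -> y = x + mvsub y x.
Proof.
move=> h; have := mv_lukasiewicz x y.
by rewrite h mvnegK add0r => {1}->; rewrite addrC.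
Qed.

Lemma mvle_trans y x z : mvle x y -> mvle y z -> mvle x z.
Proof.
by move=> /mvle_subK -> /mvle_subK ->; rewrite -addrA; exact: mvle_addr.
Qed.

Lemma mvle_add x y u v : mvle x y -> mvle u v -> mvle (x + u) (y + v).
Proof.
by move=> /mvle_subK -> /mvle_subK ->; rewrite addrACA; exact: mvle_addr.
Qed.

Lemma mvle_refl x : mvle x x.
Proof. exact: mvnegxx. Qed.

Lemma mvsub_le x y z : mvle (mvsub x y) z <-> mvle x (y + z).
Proof. by rewrite /mvle mvnegK addrA. Qed.

Lemma mvle_subD x y : mvle x (y + mvsub x y).
Proof. by apply/mvsub_le; exact: mvle_refl. Qed.

Lemma mvsub_triangle y x z : mvle (mvsub x z) (mvsub x y + mvsub y z).
Proof.
apply/mvsub_le; apply: (mvle_trans (mvle_subD x y)).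
rewrite [mvsub x y + _]addrC addrA.
by apply: mvle_add; [exact: mvle_subD | exact: mvle_refl].
Qed.

Lemma mvsub_add x y u v : mvle (mvsub (x + u) (y + v)) (mvsub x y + mvsub u v).
Proof.
by apply/mvsub_le; rewrite addrACA; apply: mvle_add; exact: mvle_subD.
Qed.

Lemma mvsub_neg x y : mvsub (mvneg x) (mvneg y) = mvsub y x.
Proof. by rewrite /mvsub mvnegK addrC. Qed.

End MVOrder.

Arguments mvone {A}.

Record mvideal (A : mvType) := MVIdeal {
  ideal_set :> set A;
  ideal0 : ideal_set 0;
  idealD : forall x y, ideal_set x -> ideal_set y -> ideal_set (x + y);
  ideal_le : forall x y, mvle y x -> ideal_set x -> ideal_set y
}.

Definition maximal_ideal (A : mvType) (M : mvideal A) : Prop :=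
  (M : set A) <> [set: A] /\
  forall J : mvideal A, M `<=` J -> (J : set A) <> [set: A] -> J = M :> set A.

Section MVQuotient.
Variables (A : mvType) (I : mvideal A).

Definition ideal_equiv (x y : A) : bool := mvdist x y \in (I : set A).

Lemma ideal_equivP x y :
  reflect (ideal_set I (mvsub x y) /\ ideal_set I (mvsub y x)) (ideal_equiv x y).
Proof.
apply: (iffP idP) => [/set_mem h|[h1 h2]]; last first.
  by apply: mem_set; exact: idealD.
split; first by apply: ideal_le h; exact: mvle_addr.
by apply: ideal_le h; rewrite /mvdist addrC; exact: mvle_addr.
Qed.

Lemma ideal_equiv_class : equiv_class_of ideal_equiv.
Proof.
split=> [x|x y|y x z].
- by apply/ideal_equivP; rewrite /mvsub mvnegxx mvnegK; split; exact: ideal0.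
- by rewrite /ideal_equiv /mvdist addrC.
- move=> /ideal_equivP[xy yx] /ideal_equivP[yz zy]; apply/ideal_equivP; split.
    by apply: ideal_le (idealD xy yz); exact: mvsub_triangle.
  by apply: ideal_le (idealD zy yx); exact: mvsub_triangle.
Qed.

Canonical ideal_equiv_equiv := EquivRelPack ideal_equiv_class.
Canonical ideal_equiv_encModRel := defaultEncModRel ideal_equiv.

Definition mvquot : Type := {eq_quot ideal_equiv}.

HB.instance Definition _ : EqQuotient A ideal_equiv mvquot :=
  EqQuotient.on mvquot.
HB.instance Definition _ := Choice.on mvquot.

Definition mvquot_zero : mvquot := lift_cst mvquot 0.
Definition mvquot_add := lift_op2 mvquot +%R.
Definition mvquot_neg := lift_op1 mvquot (@mvneg A).

Canonical pi_mvquot_zero := PiConst mvquot_zero.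

Lemma pi_mvquot_addE : {morph \pi : x y / x + y >-> mvquot_add x y}.
Proof.
move=> x y /=; unlock mvquot_add; apply/eqP; rewrite piE.
have /eqP := esym (reprK (\pi_mvquot x)).
have /eqP := esym (reprK (\pi_mvquot y)).
rewrite !piE => /ideal_equivP[y1 y2] /ideal_equivP[x1 x2].
apply/ideal_equivP; split.
  by apply: ideal_le (idealD x1 y1); exact: mvsub_add.
by apply: ideal_le (idealD x2 y2); exact: mvsub_add.
Qed.
Canonical pi_mvquot_add := PiMorph2 pi_mvquot_addE.

Lemma pi_mvquot_negE : {morph \pi : x / mvneg x >-> mvquot_neg x}.
Proof.
move=> x /=; unlock mvquot_neg; apply/eqP; rewrite piE.
have /eqP := esym (reprK (\pi_mvquot x)).
by rewrite !piE => /ideal_equivP[x1 x2]; apply/ideal_equivP; rewrite !mvsub_neg.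
Qed.
Canonical pi_mvquot_neg := PiMorph1 pi_mvquot_negE.

Lemma mvquot_addA : associative mvquot_add.
Proof. by move=> x y z; rewrite -[x]reprK -[y]reprK -[z]reprK !piE addrA. Qed.

Lemma mvquot_addC : commutative mvquot_add.
Proof. by move=> x y; rewrite -[x]reprK -[y]reprK !piE addrC. Qed.

Lemma mvquot_add0 : left_id mvquot_zero mvquot_add.
Proof. by move=> x; rewrite -[x]reprK !piE add0r. Qed.

HB.instance Definition _ :=
  GRing.isNmodule.Build mvquot mvquot_addA mvquot_addC mvquot_add0.

Lemma mvquot_negK : involutive mvquot_neg.
Proof. by move=> x; rewrite -[x]reprK !piE mvnegK. Qed.

Lemma mvquot_add1 (x : mvquot) : mvquot_neg 0 + x = mvquot_neg 0.
Proof.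
rewrite -[0]/mvquot_zero -[_ + x]/(mvquot_add _ x) -[x]reprK !piE.
by rewrite mvadd1.
Qed.

Lemma mvquot_lukasiewicz (x y : mvquot) :
  mvquot_neg (mvquot_neg x + y) + y = mvquot_neg (mvquot_neg y + x) + x.
Proof.
rewrite -[LHS]/(mvquot_add (mvquot_neg (mvquot_add (mvquot_neg x) y)) y).
rewrite -[RHS]/(mvquot_add (mvquot_neg (mvquot_add (mvquot_neg y) x)) x).
by rewrite -[x]reprK -[y]reprK !piE mv_lukasiewicz.
Qed.

HB.instance Definition _ := Nmodule_isMVAlgebra.Build mvquot
  mvquot_negK mvquot_add1 mvquot_lukasiewicz.

Lemma mvpi0 : \pi_mvquot (0 : A) = 0.
Proof. by rewrite -[RHS]/mvquot_zero !piE. Qed.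

Lemma mvpiD : {morph \pi_mvquot : x y / x + y}.
Proof. exact: pi_mvquot_addE. Qed.

Lemma mvpi_neg : {morph \pi_mvquot : x / mvneg x}.
Proof. exact: pi_mvquot_negE. Qed.

HB.instance Definition _ := hasNbhs.Build mvquot principal_filter.
HB.instance Definition _ := Discrete_ofNbhs.Build mvquot erefl.
HB.instance Definition _ := DiscreteUniform_ofNbhs.Build mvquot.

End MVQuotient.

Definition finite_rank (A : mvType) (I : mvideal A) : Prop :=
  finite_set [set: mvquot I].

(* Sends the class of x modulo I to the class of x modulo J when I `<=` J
   (lemma quot_map_pi); a junk value otherwise. *)
Definition quot_map (A : mvType) (I J : mvideal A) (c : mvquot I) : mvquot J :=
  \pi_(mvquot J) (repr c).

Lemma quot_map_pi (A : mvType) (I J : mvideal A) (x : A) : I `<=` J ->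
  quot_map J (\pi_(mvquot I) x) = \pi_(mvquot J) x.
Proof.
move=> IJ; have /eqP := reprK (\pi_(mvquot I) x).
rewrite !piE => /ideal_equivP[h1 h2]; apply/eqP; rewrite piE.
by apply/ideal_equivP; split; exact: IJ.
Qed.

Section QuotMapMorphism.
Variables (A : mvType) (I J : mvideal A).
Hypothesis IJ : I `<=` J.

Lemma quot_map0 : quot_map J (0 : mvquot I) = 0.
Proof. by rewrite -!mvpi0 quot_map_pi. Qed.

Lemma quot_mapD : {morph @quot_map A I J : x y / x + y}.
Proof.
by move=> x y; rewrite -[x]reprK -[y]reprK -mvpiD !quot_map_pi // mvpiD.
Qed.

Lemma quot_map_neg : {morph @quot_map A I J : x / mvneg x}.
Proof.
by move=> x; rewrite -[x]reprK -mvpi_neg !quot_map_pi // mvpi_neg.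
Qed.

End QuotMapMorphism.

Section QuotientProduct.
Variables (A : mvType) (K : Type) (F : K -> mvideal A).

Definition quot_prod : Type := prod_topology (fun k => mvquot (F k)).

HB.instance Definition _ := Topological.on quot_prod.

Definition quot_prod_zero : quot_prod := fun=> 0.
Definition quot_prod_add (f g : quot_prod) : quot_prod := fun k => f k + g k.
Definition quot_prod_neg (f : quot_prod) : quot_prod := fun k => mvneg (f k).

Lemma quot_prod_addA : associative quot_prod_add.
Proof. by move=> f g h; apply: functional_extensionality_dep => k; exact: addrA. Qed.

Lemma quot_prod_addC : commutative quot_prod_add.
Proof. by move=> f g; apply: functional_extensionality_dep => k; exact: addrC. Qed.

Lemma quot_prod_add0 : left_id quot_prod_zero quot_prod_add.
Proof. by move=> f; apply: functional_extensionality_dep => k; exact: add0r. Qed.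

HB.instance Definition _ :=
  GRing.isNmodule.Build quot_prod quot_prod_addA quot_prod_addC quot_prod_add0.

Lemma quot_prod_negK : involutive quot_prod_neg.
Proof. by move=> f; apply: functional_extensionality_dep => k; exact: mvnegK. Qed.

Lemma quot_prod_add1 (f : quot_prod) : quot_prod_neg 0 + f = quot_prod_neg 0.
Proof. by apply: functional_extensionality_dep => k; exact: mvadd1. Qed.

Lemma quot_prod_lukasiewicz (f g : quot_prod) :
  quot_prod_neg (quot_prod_neg f + g) + g =
  quot_prod_neg (quot_prod_neg g + f) + f.
Proof. by apply: functional_extensionality_dep => k; exact: mv_lukasiewicz. Qed.

HB.instance Definition _ := Nmodule_isMVAlgebra.Build quot_prod
  quot_prod_negK quot_prod_add1 quot_prod_lukasiewicz.

End QuotientProduct.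

Section ProfiniteCompletion.
Variable A : mvType.

Definition fin_ideal : Type := {I : mvideal A | finite_rank I}.

Definition fin_quot_prod : Type :=
  quot_prod (fun I : fin_ideal => sval I).

HB.instance Definition _ := TopMV.on fin_quot_prod.

Definition coherent_families : set fin_quot_prod :=
  [set f | forall I J : fin_ideal,
     sval I `<=` sval J -> quot_map (sval J) (f I) = f J].

Definition profinite_completion : Type := set_type coherent_families.

HB.instance Definition _ := Topological.on profinite_completion.

Lemma coherent0 : (0 : fin_quot_prod) \in coherent_families.
Proof. by apply/mem_set => I J IJ; exact: quot_map0. Qed.

Lemma coherentD (f g : profinite_completion) :
  val f + val g \in coherent_families.
Proof.
case: f g => f /= /set_mem hf [g /= /set_mem hg]; apply/mem_set => I J IJ.
by rewrite -[LHS]/(quot_map _ (f I + g I)) quot_mapD// hf// hg.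
Qed.

Lemma coherent_neg (f : profinite_completion) :
  mvneg (val f) \in coherent_families.
Proof.
case: f => f /= /set_mem hf; apply/mem_set => I J IJ.
by rewrite -[LHS]/(quot_map _ (mvneg (f I))) quot_map_neg// hf.
Qed.

Definition completion_zero : profinite_completion :=
  exist (fun f => f \in coherent_families) _ coherent0.
Definition completion_add (f g : profinite_completion) : profinite_completion :=
  exist (fun f => f \in coherent_families) _ (coherentD f g).
Definition completion_neg (f : profinite_completion) : profinite_completion :=
  exist (fun f => f \in coherent_families) _ (coherent_neg f).

Lemma completion_addA : associative completion_add.
Proof. by move=> f g h; apply: val_inj; exact: addrA. Qed.

Lemma completion_addC : commutative completion_add.
Proof. by move=> f g; apply: val_inj; exact: addrC. Qed.

Lemma completion_add0 : left_id completion_zero completion_add.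
Proof. by move=> f; apply: val_inj; exact: add0r. Qed.

HB.instance Definition _ := GRing.isNmodule.Build profinite_completion
  completion_addA completion_addC completion_add0.

Lemma completion_negK : involutive completion_neg.
Proof. by move=> f; apply: val_inj; exact: mvnegK. Qed.

Lemma completion_add1 (f : profinite_completion) :
  completion_neg 0 + f = completion_neg 0.
Proof. by apply: val_inj; exact: mvadd1. Qed.

Lemma completion_lukasiewicz (f g : profinite_completion) :
  completion_neg (completion_neg f + g) + g =
  completion_neg (completion_neg g + f) + f.
Proof. by apply: val_inj; exact: mv_lukasiewicz. Qed.

HB.instance Definition _ := Nmodule_isMVAlgebra.Build profinite_completion
  completion_negK completion_add1 completion_lukasiewicz.

End ProfiniteCompletion.

Definition fin_max_ideal (A : mvType) : Type :=
  {M : mvideal A | maximal_ideal M /\ finite_rank M}.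

Definition max_quot_prod (A : mvType) : Type :=
  quot_prod (fun M : fin_max_ideal A => sval M).

HB.instance Definition _ (A : mvType) := TopMV.on (max_quot_prod A).

Definition mv_morphism (A B : mvType) (f : A -> B) : Prop :=
  [/\ f 0 = 0, {morph f : x y / x + y} & {morph f : x / mvneg x}].

Definition top_mv_isomorphic (A B : topMVType) : Prop :=
  exists (f : A -> B) (g : B -> A),
    [/\ cancel f g, cancel g f, mv_morphism f, continuous f & continuous g].

(* Main.v *)
(* An ideal I of finite rank is the intersection of the maximal ideals above
   it: if x is not in I, some multiple e of x is a nonzero idempotent of A/I,
   so the elements below ¬e modulo I form a proper ideal, and a maximal ideal
   above it avoids x.  There are finitely many maximal ideals above I, and
   distinct maximal ideals M, N are comaximal (x in M, ¬x in N), so by the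
   Chinese remainder theorem A/I is the product of the A/M, M above I.  Hence
   restricting a coherent family to the maximal ideals is bijective; its inverse
   is continuous since the coordinate at I only depends on the finitely many
   coordinates at the maximal ideals above I. *)

From mathcomp Require Import all_boot ssralg generic_quotient finmap.
From mathcomp Require Import all_classical topology function_spaces.
Require Import Defs.

Set Implicit Arguments.
Unset Strict Implicit.
Unset Printing Implicit Defensive.

Import GRing.Theory.
Local Open Scope classical_set_scope.
Local Open Scope ring_scope.
Local Open Scope quotient_scope.

(** * Order, negation and idempotents in an MV-algebra *)

Section MVArithmetic.
Variable A : mvType.
Implicit Types x y e : A.

Lemma mvneg1 : mvneg mvone = 0 :> A.
Proof. exact: mvnegK. Qed.

Lemma mvle0x x : mvle 0 x.
Proof. exact: mvadd1. Qed.

Lemma mvlex1 x : mvle x mvone.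
Proof. by rewrite /mvle addrC; exact: mvadd1. Qed.

Lemma mvle_anti x y : mvle x y -> mvle y x -> x = y.
Proof.
by move=> xy yx; have := mv_lukasiewicz x y; rewrite xy yx mvneg1 !add0r.
Qed.

Lemma mvlex0 x : mvle x 0 -> x = 0.
Proof. by move=> x0; apply: mvle_anti x0 (mvle0x x). Qed.

Lemma mvle1x x : mvle mvone x -> x = mvone.
Proof. by move=> x1; apply: mvle_anti x1; exact: mvlex1. Qed.

Lemma mvle_neg x y : mvle x y -> mvle (mvneg y) (mvneg x).
Proof. by rewrite /mvle mvnegK addrC. Qed.

Lemma mvsubx0 x : mvsub x 0 = x.
Proof. by rewrite /mvsub addr0 mvnegK. Qed.

Lemma mvsub0x x : mvsub 0 x = 0.
Proof. by rewrite /mvsub mvadd1 mvnegK. Qed.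

Lemma mvsubx1 x : mvsub x mvone = 0.
Proof. by rewrite /mvsub addrC mvadd1 mvnegK. Qed.

Lemma mvsub_lel x y : mvle (mvsub x y) x.
Proof. by apply/mvsub_le; rewrite addrC; exact: mvle_addr. Qed.

(* The Lukasiewicz axiom equates the joins [¬e ∨ e] and [e ∨ ¬e]; the first is
   [¬(e + e) + e] and the second is [¬(¬e + ¬e) + ¬e]. *)
Lemma mv_idempotent_neg e : e + e = e -> mvneg e + mvneg e = mvneg e.
Proof.
move=> ee; apply: mvle_anti; last exact: mvle_addr.
by rewrite /mvle -[LHS]mv_lukasiewicz mvnegK ee mvnegxx.
Qed.

Lemma mvle_mulrn x m n : (m <= n)%N -> mvle (x *+ m) (x *+ n).
Proof. by move=> /subnKC <-; rewrite mulrnDr; exact: mvle_addr. Qed.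

(** The multiples of [x] increase, so once two of them coincide the chain is constant in between:
    [x *+ i + x = x *+ i]. Then [x *+ i] absorbs every multiple of [x], itself included. *)
Lemma finite_mv_idempotent x : finite_set [set: A] ->
  exists n, x *+ n + x *+ n = x *+ n /\ mvle x (x *+ n).
Proof.
move=> finA.
have [i [j [ltij eqij]]] : exists i j, (i < j)%N /\ x *+ i = x *+ j.
  apply: contrapT => h; apply: infinite_nat.
  rewrite -(preimage_setT (fun n => x *+ n)); apply: finite_preimage finA.
  move=> i j _ _ eqij; case: (ltngtP i j) => // [ij|ji]; case: h.
    by exists i, j.
  by exists j, i.
have stab : x *+ i + x = x *+ i.
  apply: mvle_anti; last exact: mvle_addr.
  by rewrite -mulrSr [X in mvle _ X]eqij; exact: mvle_mulrn.
exists i; split; last by rewrite -[X in mvle _ X]stab addrC; exact: mvle_addr.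
have absorb n : x *+ i + x *+ n = x *+ i.
  by elim: n => [|n IHn]; rewrite ?mulr0n ?addr0// mulrSr addrA IHn.
exact: absorb.
Qed.

End MVArithmetic.

(** * Maximal ideals and ideals of finite rank *)

Section Ideals.
Variable A : mvType.
Implicit Types (I J M N : mvideal A) (x y : A).

Lemma mvideal_ext I J : I = J :> set A -> I = J.
Proof.
case: I J => I I0 ID Ile [J J0 JD Jle] /= IJ.
by case: J / IJ J0 JD Jle => *; congr MVIdeal; exact: Prop_irrelevance.
Qed.

Lemma mvideal_properP I : (I : set A) <> [set: A] <-> ~ ideal_set I mvone.
Proof.
split=> [IT I1|I1 IT]; last by apply: I1; rewrite IT.
by apply: IT; apply/seteqP; split=> // x _; exact: ideal_le (mvlex1 x) I1.
Qed.

Lemma ideal_mulrn I x n : ideal_set I x -> ideal_set I (x *+ n).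
Proof.
move=> Ix; elim: n => [|n IHn]; first exact: ideal0.
by rewrite mulrS; exact: idealD.
Qed.

Lemma maximal_idealNneg M x :
  maximal_ideal M -> ideal_set M x -> ~ ideal_set M (mvneg x).
Proof.
case=> /mvideal_properP M1 _ Mx Mnx; apply: M1; rewrite -(mvnegxx x).
exact: idealD.
Qed.

Lemma ideal_sup_subproof I J :
  let S := [set x | exists y z,
    [/\ ideal_set I y, ideal_set J z & mvle x (y + z)]] in
  [/\ S 0, forall x y, S x -> S y -> S (x + y)
     & forall x y, mvle y x -> S x -> S y].
Proof.
split=> [|x x' [y [z [Iy Jz xyz]]] [y' [z' [Iy' Jz' xyz']]]|x x' xx'].
- by exists 0, 0; split; [exact: ideal0 | exact: ideal0 | exact: mvle0x].
- exists (y + y'), (z + z'); rewrite addrACA.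
  by split; [exact: idealD | exact: idealD | exact: mvle_add].
- by case=> y [z [Iy Jz xyz]]; exists y, z; split=> //; exact: mvle_trans xyz.
Qed.

Definition ideal_sup I J : mvideal A :=
  let: And3 h0 hD hle := ideal_sup_subproof I J in MVIdeal h0 hD hle.

Lemma ideal_supP I J x :
  ideal_set (ideal_sup I J) x <->
  exists y z, [/\ ideal_set I y, ideal_set J z & mvle x (y + z)].
Proof. by rewrite /ideal_sup; case: ideal_sup_subproof. Qed.

Lemma maximal_ideal_comaximal M N :
  maximal_ideal M -> maximal_ideal N -> M <> N ->
  exists x, ideal_set M x /\ ideal_set N (mvneg x).
Proof.
move=> [_ maxM] [_ maxN] MN.
have subM : M `<=` ideal_sup M N.
  move=> x Mx; apply/ideal_supP; exists x, 0.
  by rewrite addr0; split=> //; [exact: ideal0 | exact: mvle_refl].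
have subN : N `<=` ideal_sup M N.
  move=> x Nx; apply/ideal_supP; exists 0, x.
  by rewrite add0r; split=> //; [exact: ideal0 | exact: mvle_refl].
have [|sup1] := pselect (ideal_set (ideal_sup M N) mvone); last first.
  case: MN; apply: mvideal_ext.
  (* A proper sum would equal both [M] and [N] by maximality. *)
  have supT := (mvideal_properP (ideal_sup M N)).2 sup1.
  exact: etrans (esym (maxM _ subM supT)) (maxN _ subN supT).
move=> /ideal_supP[x [y [Mx Ny xy]]]; exists x; split=> //.
(* [x + y = mvone] says exactly that [mvneg x] lies below [y]. *)
by apply: ideal_le Ny; rewrite /mvle mvnegK; exact: mvle1x.
Qed.

Lemma maximal_ideal_exists I : (I : set A) <> [set: A] ->
  exists M, maximal_ideal M /\ I `<=` M.
Proof.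
move=> /mvideal_properP I1.
pose T := {J : mvideal A | I `<=` J /\ ~ ideal_set J mvone}.
pose R (J K : T) : bool := `[< sval J `<=` sval K >].
have [|||C totC|[M [IM M1]] maxM] := @Zorn T R.
- by move=> J; apply/asboolP.
- move=> J K L /asboolP JK /asboolP KL; apply/asboolP.
  exact: subset_trans KL.
- move=> [J hJ] [K hK] /asboolP JK /asboolP KJ; apply: eq_exist.
  exact/mvideal_ext/seteqP.
(* Upper bound of the chain [C]: its union, with [I] added so that the empty chain is covered too.
   By [common], closure of [S] is checked inside a single ideal. *)
- pose S := [set x | ideal_set I x \/ exists2 J, C J & ideal_set (sval J) x].
  have common x y : S x -> S y ->
      exists J : mvideal A, [/\ ideal_set J x, ideal_set J y & J `<=` S].
    have inC (J : T) : C J -> sval J `<=` S by move=> CJ z Jz; right; exists J.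
    have subI (J : T) : I `<=` sval J by case: J => J [].
    case=> [Ix|[J CJ Jx]] [Iy|[K CK Ky]].
    + by exists I; split=> // z; left.
    + by exists (sval K); split; [exact: subI | | exact: inC].
    + by exists (sval J); split; [ | exact: subI | exact: inC].
    + case: (totC _ _ CJ CK) => /asboolP JK.
        by exists (sval K); split; [exact: JK | | exact: inC].
      by exists (sval J); split; [ | exact: JK | exact: inC].
  have S0 : S 0 by left; exact: ideal0.
  have SD x y : S x -> S y -> S (x + y).
    by move=> Sx /(common _ _ Sx)[J [Jx Jy]]; apply; exact: idealD.
  have Sle x y : mvle y x -> S x -> S y.
    move=> yx Sx; have [J [Jx _ JS]] := common _ _ Sx Sx.
    by apply: JS; exact: ideal_le yx Jx.
  have hS : I `<=` MVIdeal S0 SD Sle /\ ~ ideal_set (MVIdeal S0 SD Sle) mvone.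
    by split=> [x|[//|[[J [_ J1]] _ /J1]]]; first by left.
  exists (exist _ (MVIdeal S0 SD Sle) hS) => J CJ; apply/asboolP => x Jx.
  by right; exists J.
exists M; split=> //; split; first exact/mvideal_properP.
move=> J MJ /mvideal_properP J1.
have hJ : I `<=` J /\ ~ ideal_set J mvone by split=> //; exact: subset_trans MJ.
by have /asboolP/(maxM (exist _ J hJ))[->] := MJ.
Qed.

Lemma pi_mvsub I x y :
  \pi_(mvquot I) (mvsub x y) = mvsub (\pi_(mvquot I) x) (\pi_(mvquot I) y).
Proof. by rewrite /mvsub mvpi_neg mvpiD mvpi_neg. Qed.

Lemma pi_mvone I : \pi_(mvquot I) mvone = mvone.
Proof. by rewrite /mvone mvpi_neg mvpi0. Qed.

Lemma pi_mulrn I x n : \pi_(mvquot I) (x *+ n) = \pi_(mvquot I) x *+ n.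
Proof.
by elim: n => [|n IHn]; rewrite ?mvpi0// !mulrS mvpiD IHn.
Qed.

Lemma pi_eqP I x y :
  \pi_(mvquot I) x = \pi_(mvquot I) y <->
  ideal_set I (mvsub x y) /\ ideal_set I (mvsub y x).
Proof.
split=> [/eqP|h]; first by rewrite piE => /ideal_equivP.
by apply/eqP; rewrite piE; apply/ideal_equivP.
Qed.

Lemma pi_eq0 I x : \pi_(mvquot I) x = 0 <-> ideal_set I x.
Proof.
rewrite -mvpi0 pi_eqP mvsubx0 mvsub0x.
by split=> [[]//|Ix]; split=> //; exact: ideal0.
Qed.

Lemma pi_mvle I x y : mvle x y -> mvle (\pi_(mvquot I) x) (\pi_(mvquot I) y).
Proof. by rewrite /mvle -mvpi_neg -mvpiD => ->; exact: pi_mvone. Qed.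

(** Idempotence of the class of [x] is what closes the set of elements below it under addition. *)
Lemma ideal_below_subproof I x :
  let S := [set y | mvle (\pi_(mvquot I) y) (\pi_(mvquot I) x)] in
  \pi_(mvquot I) x + \pi_(mvquot I) x = \pi_(mvquot I) x ->
  [/\ S 0, forall y z, S y -> S z -> S (y + z)
     & forall y z, mvle z y -> S y -> S z].
Proof.
move=> S xx; split=> [|y z Sy Sz|y z zy].
- by rewrite /S /= mvpi0; exact: mvle0x.
- by rewrite /S /= mvpiD -xx; exact: mvle_add.
- by rewrite /S /=; apply: mvle_trans; exact: pi_mvle.
Qed.

Lemma finite_rank_separate I x : finite_rank I -> ~ ideal_set I x ->
  exists M, [/\ maximal_ideal M, I `<=` M & ~ ideal_set M x].
Proof.
move=> finI Ix.
have [n [ee xe]] := finite_mv_idempotent (\pi_(mvquot I) x) finI.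
(* Here [e] is the complement of the idempotent multiple of [x]; [J] below is the ideal of elements
   under [e] modulo [I]. *)
set e := mvneg (x *+ n).
have : \pi_(mvquot I) e + \pi_(mvquot I) e = \pi_(mvquot I) e.
  by rewrite /e mvpi_neg pi_mulrn; exact: mv_idempotent_neg.
case/ideal_below_subproof => h0 hD hle.
pose J := MVIdeal h0 hD hle.
have /maximal_ideal_exists[M [maxM JM]] : (J : set A) <> [set: A].
  (* If [J] contained [mvone], then [e] would be 1 and [x *+ n] would be 0 modulo [I]; as [x] lies
     below [x *+ n] there, [x] would be in [I]. *)
  apply/mvideal_properP; rewrite /J /= pi_mvone => /mvle1x.
  rewrite /e mvpi_neg pi_mulrn => /(can_inj (@mvnegK _)) e0.
  by apply: Ix; apply/pi_eq0/mvlex0; rewrite e0 in xe.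
exists M; split=> // [y Iy|Mx].
  by apply: JM; rewrite /J /= (pi_eq0 I y).2//; exact: mvle0x.
apply: (maximal_idealNneg maxM (ideal_mulrn n Mx)).
by apply: JM; exact: mvle_refl.
Qed.

Lemma quot_map_separate I (c d : mvquot I) : finite_rank I ->
  (forall M, maximal_ideal M -> I `<=` M -> quot_map M c = quot_map M d) ->
  c = d.
Proof.
move=> finI; rewrite -[c]reprK -[d]reprK => cd; apply/pi_eqP; split.
all: apply: contrapT => /(finite_rank_separate finI)[M [maxM IM]]; apply.
all: by have := cd M maxM IM; rewrite !quot_map_pi// => /pi_eqP[].
Qed.

(** [quot_map] sends A/I onto A/J. Hence all maximal ideals above an ideal of finite rank belong to
    Max_f(A). *)
Lemma finite_rankS I J : I `<=` J -> finite_rank I -> finite_rank J.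
Proof.
move=> IJ /(finite_image (@quot_map _ I J)); apply: sub_finite_set => c _.
by exists (\pi_(mvquot I) (repr c)) => //; rewrite quot_map_pi// reprK.
Qed.

(** An ideal above [I] is a union of classes modulo [I], so it is determined by its [trace], a
    subset of the finite set of classes. *)
Lemma finite_ideals_above I : finite_rank I ->
  finite_set [set J : mvideal A | I `<=` J].
Proof.
move=> /finite_fsetP[X XE].
pose trace J := [fset c in X | repr c \in (J : set A)]%fset.
have memJ J x : I `<=` J -> ideal_set J x <-> \pi_(mvquot I) x \in trace J.
  move=> IJ; have /= Xx : [set` X] (\pi_(mvquot I) x) by rewrite -XE.
  rewrite !inE Xx /= -(pi_eq0 J) -(quot_map_pi _ IJ) /quot_map /=.
  by rewrite pi_eq0; split=> [/mem_set|/set_mem].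
rewrite -(eq_finite_set (@inj_card_eq _ _ _ trace _)); last first.
  move=> J K /set_mem IJ /set_mem IK JK; apply: mvideal_ext.
  by apply/seteqP; split=> x; rewrite (memJ J)// (memJ K)// JK.
apply: sub_finite_set (finite_fset (fpowerset X)) => _ [J _ <-] /=.
by rewrite fpowersetE; apply/fsubsetP => c; rewrite !inE => /andP[].
Qed.

End Ideals.

(** * Chinese remainder theorem for comaximal ideals *)

Section ChineseRemainder.
Variables (A : mvType) (K : eqType) (F : K -> mvideal A).
Hypothesis comaxF : forall k l, k <> l ->
  exists x, ideal_set (F k) x /\ ideal_set (F l) (mvneg x).

(** Provides [u] congruent to 1 modulo [F k] and to 0 modulo each [F l] with [l] in [s]: the
    selector for the Chinese remainder theorem. *)
Lemma ideal_avoid k (s : seq K) : k \notin s ->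
  exists u, ideal_set (F k) (mvneg u) /\ forall l, l \in s -> ideal_set (F l) u.
Proof.
elim: s => [_|l s IHs].
  by exists mvone; rewrite mvneg1; split=> //; exact: ideal0.
rewrite inE negb_or => /andP[/eqP kl /IHs[u [ku su]]].
have [x [kx lx]] := comaxF kl.
(* The witness is [mvsub u x]: it lies below [u], which handles [s], and below [mvneg x], which
   handles [l]. *)
exists (mvneg (mvneg u + x)); rewrite mvnegK; split; first exact: idealD.
move=> m; rewrite inE => /predU1P[->|/su]; last first.
  exact/ideal_le/mvsub_lel.
apply: ideal_le lx; apply: mvle_neg; rewrite addrC; exact: mvle_addr.
Qed.

Lemma chinese_remainder (c : forall k, mvquot (F k)) (s : seq K) :
  exists x, forall k, k \in s -> \pi x = c k.
Proof.
elim: s => [|k s [x xs]]; first by exists 0.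
have [ks|/ideal_avoid[u [ku su]]] := boolP (k \in s).
  by exists x => l; rewrite inE => /predU1P[->|]; exact: xs.
(* Subtracting 0 changes nothing and subtracting 1 gives 0: modulo [F k] only the second term
   survives, modulo the ideals of [s] only the first. *)
exists (mvsub x u + mvsub (repr (c k)) (mvneg u)) => l.
rewrite mvpiD !pi_mvsub mvpi_neg.
rewrite inE; case: eqVneq => [->{l} _|_ /= ls].
  have := ku; rewrite -pi_eq0 mvpi_neg => h.
  by rewrite h mvsubx0 reprK -[X in mvsub _ X]mvnegK h mvsubx1 add0r.
have /pi_eq0 -> := su l ls.
by rewrite mvsubx0 mvsubx1 addr0; exact: xs.
Qed.

End ChineseRemainder.

(** * Product topology of discrete quotients *)

(** The factors are discrete, so a map into the product is continuous once each coordinate is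
    locally constant. *)
Lemma quot_prod_continuous (T : topologicalType) (A : mvType) (K : Type)
    (F : K -> mvideal A) (f : T -> quot_prod F) :
  (forall k x, \forall y \near x, f y k = f x k) -> continuous f.
Proof.
move=> cf x; apply/cvg_sup => k.
apply: (@continuous_comp_initial _ T _ _ f) => {}x; exact/discrete_cvg/cf.
Qed.

Lemma quot_prod_near (A : mvType) (K : Type) (F : K -> mvideal A)
    (f : quot_prod F) (k : K) : \forall g \near f, g k = f k.
Proof.
exact: (@proj_continuous {classic K} (fun k => mvquot (F k)) k f
  _ (discrete_set1 (f k))).
Qed.

Lemma quot_prod_near_seq (A : mvType) (K : eqType) (F : K -> mvideal A)
    (f : quot_prod F) (s : seq K) :
  \forall g \near f, forall k, k \in s -> g k = f k.
Proof.
elim: s => [|k s IHs]; first by near=> g.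
near=> g; move=> l; rewrite inE => /predU1P[->|].
  by near: g; exact: quot_prod_near.
by move: l; near: g.
Unshelve. all: by end_near. Qed.

(** * Restriction to maximal ideals and its inverse *)

Section FiniteQuotients.
Variable A : mvType.
Implicit Types (I : fin_ideal A) (M : fin_max_ideal A).

Lemma fin_max_ideal_comaximal M N :
  M <> N -> exists x, ideal_set (sval M) x /\ ideal_set (sval N) (mvneg x).
Proof.
move=> MN; apply: maximal_ideal_comaximal => [||E].
- by case: (svalP M).
- by case: (svalP N).
- by apply: MN; case: M N E => M hM [N hN] /= E; exact: eq_exist.
Qed.

(** [{classic _}] supplies the equality needed for membership in a sequence, the form in which the
    Chinese remainder theorem takes its finite set of ideals. *)
Lemma fin_max_ideals_above I : exists s : seq {classic fin_max_ideal A},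
  forall M, sval I `<=` sval M -> M \in s.
Proof.
have : finite_set [set M : {classic fin_max_ideal A} | sval I `<=` sval M].
  apply: finite_preimage (finite_ideals_above (svalP I)) => M N _ _.
  by case: M N => M hM [N hN] /= E; exact: eq_exist.
move=> /finite_seqP[s sE]; exists s => M IM.
by have : [set` s] M by rewrite -sE.
Qed.

Lemma fin_quot_separate I (c d : mvquot (sval I)) :
  (forall M, sval I `<=` sval M -> quot_map (sval M) c = quot_map (sval M) d) ->
  c = d.
Proof.
move=> cd; apply: (quot_map_separate (svalP I)) => M maxM IM.
exact: (cd (exist _ M (conj maxM (finite_rankS IM (svalP I)))) IM).
Qed.

(** The Chinese remainder theorem for the finitely many maximal ideals above [I]. Choice turns
    existence into a [sig], from which [glue] extracts its coordinate at [I]. *)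
Lemma fin_quot_exists (c : max_quot_prod A) I :
  { d : mvquot (sval I) |
    forall M, sval I `<=` sval M -> quot_map (sval M) d = c M }.
Proof.
apply: cid; have [s sP] := fin_max_ideals_above I.
have [x xs] := @chinese_remainder A {classic fin_max_ideal A} _
  fin_max_ideal_comaximal c s.
by exists (\pi_(mvquot (sval I)) x) => M IM; rewrite quot_map_pi// xs// sP.
Qed.

Definition glue (c : max_quot_prod A) : fin_quot_prod A :=
  fun I => sval (fin_quot_exists c I).

Lemma glueP c I M : sval I `<=` sval M -> quot_map (sval M) (glue c I) = c M.
Proof. exact: svalP (fin_quot_exists c I) M. Qed.

Lemma quot_map_comp (I J K : mvideal A) (c : mvquot I) : I `<=` J -> J `<=` K ->
  quot_map K (quot_map J c) = quot_map K c.
Proof.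
move=> IJ JK; have IK := subset_trans IJ JK.
by rewrite -[c]reprK (quot_map_pi _ IJ) (quot_map_pi _ JK) (quot_map_pi _ IK).
Qed.

Lemma glue_coherent c : glue c \in @coherent_families A.
Proof.
(* Coherence is tested modulo each [M] above [J]; such an [M] is also above [I], so both sides
   become [c M]. *)
apply/mem_set => I J IJ; apply: fin_quot_separate => M JM.
by rewrite quot_map_comp// !glueP//; exact: subset_trans IJ JM.
Qed.

Definition glue_completion (c : max_quot_prod A) : profinite_completion A :=
  exist _ (glue c) (glue_coherent c).

Definition fin_max_fin M : fin_ideal A := exist _ (sval M) (svalP M).2.

Definition max_restrict (f : profinite_completion A) : max_quot_prod A :=
  fun M => val f (fin_max_fin M).

Lemma max_restrictK : cancel max_restrict glue_completion.
Proof.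
move=> f; apply: val_inj; apply: functional_extensionality_dep => I.
apply: fin_quot_separate => M IM; rewrite glueP//.
(* Coherence of [f] from [I] to [M] identifies the reduction of its coordinate at [I] with its
   coordinate at [M]. *)
by rewrite /max_restrict -(set_mem (valP f) I (fin_max_fin M)).
Qed.

Lemma glue_completionK : cancel glue_completion max_restrict.
Proof.
move=> c; apply: functional_extensionality_dep => M.
(* Take [I] to be [M] itself: [quot_map] from A/M to A/M is the identity. *)
rewrite -(@glueP c (fin_max_fin M) M)//.
by rewrite /max_restrict /= /quot_map reprK.
Qed.

Lemma max_restrict_continuous : continuous max_restrict.
Proof.
apply: quot_prod_continuous => M f.
exact: (@initial_continuous _ _ (fun g : profinite_completion A => val g) f
  _ (quot_prod_near (val f) (fin_max_fin M))).
Qed.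

Lemma glue_near c I : \forall c' \near c, glue c' I = glue c I.
Proof.
have [s sP] := fin_max_ideals_above I.
have := @quot_prod_near_seq A {classic fin_max_ideal A} _ c s.
apply: filterS => c' cc'; apply: fin_quot_separate => M IM.
by rewrite !glueP// cc'// sP.
Qed.

Lemma glue_completion_continuous : continuous glue_completion.
Proof.
(* The completion has the subspace topology, so continuity is checked after inclusion into the
   product. *)
apply: continuous_comp_initial; apply: quot_prod_continuous => I c.
exact: glue_near.
Qed.

End FiniteQuotients.

Theorem theorem2p4 (A : mvType) :
  top_mv_isomorphic (profinite_completion A) (max_quot_prod A).
Proof.
exists (@max_restrict A), (@glue_completion A); split.
- exact: max_restrictK.
- exact: glue_completionK.
(* The operations on both sides are coordinatewise, so restriction preserves them by computation. *)
- by split.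
- exact: max_restrict_continuous.
- exact: glue_completion_continuous.
Qed.
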